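(* Let $\mathbb{F}_q$ be a finite field with $q$ elements, $q>3$. Let $F_1,\dots,F_5$ be linearly independent (over $\mathbb{F}_q$) homogeneous polynomials of degree $2$ in $\mathbb{F}_q[x_0,x_1,x_2,x_3]$. Then $$|\mathsf{V}(F_1,\dots,F_5)|\le 2q+1 .$$
   Context: $\mathsf{V}(F_1,\dots,F_5)$ denotes the set of common zeros of $F_1,\dots,F_5$ in $\mathbb{P}^3(\mathbb{F}_q)$ (i.e. $\mathbb{F}_q$-rational points). *)

(* Defs.v *)
From HB Require Import structures.
From mathcomp Require Import all_boot all_order all_algebra all_field.
From mathcomp Require Export mpoly.

Set Implicit Arguments.
Unset Strict Implicit.
Unset Printing Implicit Defensive.

Import GRing.Theory.
Local Open Scope ring_scope.

(* The point [v_0 : ... : v_n] is the set of all nonzero multiples of v; it is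
   a genuine point only when v != 0. *)
Definition proj_point (K : finFieldType) (n : nat) (v : 'rV[K]_n.+1) :
    {set 'rV[K]_n.+1} :=
  [set a *: v | a : K & a != 0].

Definition proj_space (K : finFieldType) (n : nat) : {set {set 'rV[K]_n.+1}} :=
  [set proj_point v | v : 'rV[K]_n.+1 & v != 0].

(* Vanishing is required at every representative of a point; for homogeneous
   polynomials this does not depend on the representative. *)
Definition proj_zeros (K : finFieldType) (n : nat) (s : seq {mpoly K[n.+1]}) :
    {set {set 'rV[K]_n.+1}} :=
  [set P in proj_space K n |
    [forall v in P, all (fun p => p.@[fun i => v 0 i] == 0) s]].

(* Main.v *)
(* If six of the common zeros can be ordered so that each of them is avoided by
   a product of two linear forms vanishing at the points that come after it,
   then they impose independent conditions on quadrics; as quadrics in P^3 form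
   a space of dimension 10, at most four independent ones vanish at all six
   points.  So it is enough to find such a sextuple among any 2q + 2 points.
   It is built along a flag l < H < P^3 (line, plane): independent vectors off
   H may precede any admissible sequence in H, using products with the equation
   of H, and similarly for l in H.  If three points are collinear, take l to be
   their line and H the plane joining l to another point; otherwise take H to be
   the plane of any three of the points.  When all points lie in H, projecting
   from a point bounds how many of them can obstruct the construction. *)
From HB Require Import structures.
Require Import Defs.
From mathcomp Require Import all_boot all_order all_algebra all_field.
From mathcomp Require Import mpoly.

Set Implicit Arguments.
Unset Strict Implicit.
Unset Printing Implicit Defensive.

Import GRing.Theory.
Local Open Scope ring_scope.

(** * Linear forms separating vectors from subspaces *)

Section LinearForms.

Variables (K : fieldType) (V : vectType K).
Implicit Types (U W : {vspace V}) (f : 'Hom(V, K^o)).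

(** The component of [v] along a complement of [U] is nonzero, so one of its coordinates is.
    Composing that coordinate with the projection of kernel [U] gives the form. *)
Lemma separating_form U v :
  v \notin U -> exists2 f : 'Hom(V, K^o), (U <= lker f)%VS & f v != 0.
Proof.
move=> vU; pose w := v - projv U v.
have w_neq0 : w != 0.
  by apply: contra vU; rewrite subr_eq0 => /eqP ->; exact: memv_proj.
have [i wi] : exists i, coord (vbasis {:V}) i w != 0.
  apply/existsP; apply: contraR w_neq0 => /existsPn c0.
  rewrite (coord_vbasis (memvf w)) big1 // => i _.
  by move: (c0 i); rewrite negbK => /eqP ->; rewrite scale0r.
exists (linfun (coord (vbasis {:V}) i : V -> K^o) \o (\1 - projv U))%VF.
  apply/subvP=> u uU; rewrite memv_ker comp_lfunE !lfunE /= !lfunE /=.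
  by rewrite projv_id // subrr linear0.
by rewrite comp_lfunE !lfunE /= !lfunE /=.
Qed.

(** A form vanishing on [U] but not on all of [W] cuts [W] in a proper subspace containing [U];
    codimension one forces equality. *)
Lemma hyperplane_form U W :
    (U <= W)%VS -> \dim W = (\dim U).+1 ->
  exists f : 'Hom(V, K^o), forall v, v \in W -> (f v == 0) = (v \in U).
Proof.
move=> UW dimW.
have /subvPn[w wW wU] : ~~ (W <= U)%VS.
  by apply: contraTN isT => /dimvS; rewrite dimW ltnn.
have [f Uf fw] := separating_form wU; exists f => v vW.
suff -> : U = (W :&: lker f)%VS by rewrite memv_cap vW memv_ker.
apply/eqP; rewrite eqEdim subv_cap UW Uf /= -ltnS -dimW ltn_neqAle.
rewrite dimvS ?capvSl // andbT; apply: contra fw => dimE.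
have /subvP : (W <= W :&: lker f)%VS.
  by rewrite -(geq_leqif (dimv_leqif_sup (capvSl _ _))) (eqP dimE).
by move=> /(_ w wW); rewrite memv_cap memv_ker => /andP[].
Qed.

Lemma free2_notin (x y : V) : free [:: x; y] -> x \notin <[y]>%VS.
Proof. by rewrite free_cons span_seq1 => /andP[]. Qed.

End LinearForms.

(** * Conditions imposed on quadrics by points *)

Section Quadrics.

Variables (K : fieldType) (n : nat).
Local Notation V := 'rV[K]_n.+1.
Local Notation quadric := (dhomog n.+1 K 2).
Implicit Types (f g h : 'Hom(V, K^o)) (v : V) (ps : seq V).

Definition mpoly_of_form f : {mpoly K[n.+1]} :=
  \sum_i f (delta_mx 0 i) *: 'X_i.

Lemma form_homog f : mpoly_of_form f \is 1.-homog.
Proof.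
by apply: rpred_sum => i _; apply: rpredZ; rewrite dhomogX; apply/eqP/mdeg1.
Qed.

Lemma meval_form f v : (mpoly_of_form f).@[fun i => v 0 i] = f v.
Proof.
rewrite /mpoly_of_form raddf_sum [in RHS](row_sum_delta v) linear_sum /=.
by apply: eq_bigr => i _; rewrite mevalZ mevalXU linearZ /= mulrC.
Qed.

Lemma form_mul_homog f g : mpoly_of_form f * mpoly_of_form g \is 2.-homog.
Proof. exact: (dhomogM (form_homog f) (form_homog g)). Qed.

Definition form_mul f g : quadric := DHomog (form_mul_homog f g).

Definition quadric_eval v (p : quadric) : K^o :=
  (p : {mpoly K[n.+1]}).@[fun i => v 0 i].

Lemma quadric_eval_linear v : linear (quadric_eval v).
Proof. by move=> a p q; rewrite /quadric_eval /= mevalD mevalZ. Qed.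

HB.instance Definition _ v :=
  GRing.isLinear.Build K quadric K^o _ (quadric_eval v) (quadric_eval_linear v).

Lemma eval_form_mul v f g : quadric_eval v (form_mul f g) = f v * g v.
Proof. by rewrite /quadric_eval /= mevalM !meval_form. Qed.

Lemma dim_quadrics : \dim {:quadric} = 'C(n.+2, 2).
Proof. by rewrite dimvf. Qed.

Definition quadrics_through ps : {vspace quadric} :=
  (\bigcap_(v <- ps) lker (linfun (quadric_eval v)))%VS.

(** A triangularity condition: the evaluations of the products [f * g] at the points form a
    triangular matrix with nonzero diagonal. The order of [ps] therefore matters. *)
Fixpoint spread ps : Prop :=
  if ps is v :: ps' then
    (exists f g, f v * g v != 0 /\ {in ps', forall u, f u * g u = 0})
    /\ spread ps'
  else True.

Lemma mem_quadrics_through ps q :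
  (q \in quadrics_through ps) = all (fun v => quadric_eval v q == 0) ps.
Proof.
elim: ps => [|v ps IHps]; rewrite /quadrics_through ?big_nil ?memvf //.
by rewrite big_cons memv_cap memv_ker lfunE IHps.
Qed.

(** The product attached to the head of the list passes through the tail but not through the head,
    so each point lowers the dimension by at least one. *)
Lemma dim_quadrics_through ps :
  spread ps -> (\dim (quadrics_through ps) + size ps <= 'C(n.+2, 2))%N.
Proof.
elim: ps => [_|v ps IHps /= [[f [g [fgv fg0]]] /IHps]].
  by rewrite /quadrics_through big_nil addn0 dim_quadrics.
apply: leq_trans; rewrite addnS -addSn leq_add2r.
have sub : (quadrics_through (v :: ps) <= quadrics_through ps)%VS.
  by rewrite /quadrics_through big_cons capvSr.
rewrite (ltn_leqif (dimv_leqif_sup sub)); apply/subvPn.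
exists (form_mul f g); rewrite mem_quadrics_through.
  by apply/allP => u /fg0 fgu; rewrite eval_form_mul fgu.
by rewrite /= eval_form_mul negb_and fgv.
Qed.

Lemma spread_bound (F : seq quadric) ps :
    free F -> spread ps ->
    (forall (p : quadric) v, p \in F -> v \in ps ->
       (p : {mpoly K[n.+1]}).@[fun i => v 0 i] = 0) ->
  (size F + size ps <= 'C(n.+2, 2))%N.
Proof.
move=> freeF sps F0; apply: leq_trans (dim_quadrics_through sps).
rewrite leq_add2r.
move: freeF; rewrite /free => /eqP <-; apply/dimvS/span_subvP => p pF.
by rewrite mem_quadrics_through; apply/allP => v vps; apply/eqP/F0.
Qed.

(** For [v] in [X], multiply [h] by a form separating [v] from the span of the later vectors of [X]:
    the first factor kills [ps], the second kills the rest of [X]. *)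
Lemma spread_layer h ps (X : seq V) :
    free X -> {in X, forall v, h v != 0} -> {in ps, forall v, h v = 0} ->
  spread ps -> spread (X ++ ps).
Proof.
move=> + + hps sps; elim: X => //= v X IHX.
rewrite free_cons => /andP[vX freeX] hX.
split; last by apply: IHX => // u uX; apply: hX; rewrite inE uX orbT.
have [g Xg gv] := separating_form vX; exists h, g; split.
  by rewrite mulf_neq0 // hX ?mem_head.
move=> u; rewrite mem_cat => /orP[uX|/hps ->]; last by rewrite mul0r.
by have /(subvP Xg) := memv_span uX; rewrite memv_ker => /eqP ->; rewrite mulr0.
Qed.

(** Only pairwise independence is asked, so collinear triples are covered: a form killing [y] times
    one killing [z] handles [x], and squares of forms handle [y] and [z]. *)
Lemma spread3 (x y z : V) :
  free [:: x; y] -> free [:: x; z] -> free [:: y; z] -> spread [:: x; y; z].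
Proof.
move=> xy xz yz.
have [f + fx] := separating_form (free2_notin xy).
have [g + gx] := separating_form (free2_notin xz).
have [h + hy] := separating_form (free2_notin yz).
rewrite -!memvE !memv_ker => /eqP hz /eqP gz /eqP fy.
have z_neq0 : z \notin 0%VS.
  by move: yz; rewrite !free_cons span_nil memv0 => /and3P[].
have [k _ kz] := separating_form z_neq0.
split; first exists f, g; first split; first by rewrite mulf_neq0.
  by move=> u; rewrite !inE => /orP[]/eqP->; rewrite ?fy ?gz ?mul0r ?mulr0.
split; first exists h, h; first split; first by rewrite mulf_neq0.
  by move=> u; rewrite !inE => /eqP->; rewrite hz mul0r.
by split=> //; exists k, k; split=> //; rewrite mulf_neq0.
Qed.

End Quadrics.


Lemma span_free_eq (K : fieldType) (V : vectType K) (W : {vspace V})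
    (X : seq V) :
  free X -> {subset X <= W} -> \dim W = size X -> (W <= <<X>>)%VS.
Proof.
move=> freeX /span_subvP XW dimW; rewrite -(geq_leqif (dimv_leqif_sup XW)).
by rewrite dimW; move: freeX; rewrite /free => /eqP ->.
Qed.

(** One step of the flag: the equation of [U] in [W] is the common factor [h] of [spread_layer]. *)
Lemma spread_flag (K : fieldType) n (U W : {vspace 'rV[K]_n.+1})
    (X ps : seq 'rV[K]_n.+1) :
    (U <= W)%VS -> \dim W = (\dim U).+1 -> free X ->
    {in X, forall v, (v \in W) && (v \notin U)} -> {subset ps <= U} ->
  spread ps -> spread (X ++ ps).
Proof.
move=> UW dimW freeX XW psU; have [h hE] := hyperplane_form UW dimW.
apply: (spread_layer (h := h)) => // v; first by case/XW/andP=> /hE ->.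
by move/psU=> vU; apply/eqP; rewrite hE // (subvP UW).
Qed.

(** * Counting points on lines and pencils *)

Section FinitePointSets.

Variable K : finFieldType.
Local Notation q := #|K|.

(* Projecting from U maps S injectively to the affine line obtained from the
   pencil P(W/U) by removing its member L. *)
Lemma pencil_bound m (U L W : {vspace 'rV[K]_m}) (S : {set 'rV[K]_m}) :
    (U <= L)%VS -> (L <= W)%VS -> \dim L = (\dim U).+1 ->
    \dim W = (\dim L).+1 ->
    {in S, forall s, (s \in W) && (s \notin L)} ->
    {in S &, forall s t, s != t -> (W <= U + <<[:: s; t]>>)%VS} ->
  (#|S| <= q)%N.
Proof.
move=> UL LW dimL dimW SW SWst.
have [a aE] := hyperplane_form LW dimW.
have /subvPn[w wL wU] : ~~ (L <= U)%VS.
  by apply: contraTN isT => /dimvS; rewrite dimL ltnn.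
have [b Ub bw] := separating_form wU.
have aL v : v \in L -> a v = 0.
  by move=> vL; apply/eqP; rewrite aE // (subvP LW).
have aS s : s \in S -> a s != 0 by case/SW/andP=> /aE ->.
(* The ratio [b / a] is the affine coordinate on the pencil; its pole, where [a] vanishes, is the
   removed member [L]. *)
suff injS : {in S &, injective (fun s => b s / a s)}.
  by rewrite -(card_in_imset injS) max_card.
(* If distinct [s] and [t] had the same ratio [c], then [b - c * a] would vanish on [U], [s] and
   [t], hence on [W]; as [a w = 0], this contradicts [b w != 0]. *)
move=> s t sS tS eq_st; apply: contraNeq bw => /(SWst _ _ sS tS) Wst.
pose c := b s / a s; pose f : 'Hom('rV[K]_m, K^o) := b - c *: a.
have fE v : f v = b v - c * a v by rewrite !lfunE /= !lfunE /= lfunE.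
suff /(subv_trans Wst)/subvP/(_ w) : (U + <<[:: s; t]>> <= lker f)%VS.
  by rewrite memv_ker fE aL // mulr0 subr0; apply; apply: (subvP LW).
rewrite subv_add; apply/andP; split.
  apply/subvP => v vU; rewrite memv_ker fE aL ?(subvP UL) // mulr0 subr0.
  by rewrite -memv_ker (subvP Ub).
apply/span_subvP => v; rewrite !inE memv_ker fE => /orP[]/eqP->.
  by rewrite divfK ?subrr ?aS.
by rewrite /c eq_st divfK ?subrr ?aS.
Qed.

(** Two or more such vectors represent distinct projective points, so cardinals count points rather
    than vectors. *)
Definition pairwise_free m (R : {set 'rV[K]_m}) :=
  {in R &, forall x y, x != y -> free [:: x; y]}.

Definition pts m (W : {vspace 'rV[K]_m}) : {set 'rV[K]_m} := [set v | v \in W].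

Lemma card_split m (R A : {set 'rV[K]_m}) : (#|R| = #|R :&: A| + #|R :\: A|)%N.
Proof. by rewrite cardsID. Qed.

(** Removing [y] leaves points of an affine line: [pencil_bound] applies with the flag 0 < [<[y]>] <
    [l]. *)
Lemma line_bound m (R : {set 'rV[K]_m}) x y :
    pairwise_free R -> x \in R -> y \in R -> x != y ->
  (#|R :&: pts <<[:: x; y]>>| <= q.+1)%N.
Proof.
move=> freeR xR yR xy; set l := (<<_>>)%VS.
have freexy : free [:: x; y] by apply: freeR.
have diml : \dim l = 2%N by apply/eqP.
have yl : y \in l by rewrite memv_span // !inE eqxx orbT.
have y_neq0 : y != 0.
  by move: freexy; rewrite !free_cons span_nil memv0 => /and3P[].
rewrite (cardsD1 y) !inE yR yl add1n ltnS.
apply: (@pencil_bound _ 0%VS <[y]>%VS l).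
- exact: sub0v.
- by rewrite -memvE.
- by rewrite (dim_vline y) y_neq0 dimv0.
- by rewrite (dim_vline y) y_neq0.
- move=> s; rewrite !inE => /and3P[sy sR ->] /=.
  by apply: free2_notin; apply: freeR.
move=> s t; rewrite !inE => /and3P[_ sR sl] /and3P[_ tR tl] st.
rewrite add0v; apply: span_free_eq; rewrite ?diml ?freeR //.
by move=> v; rewrite !inE => /orP[]/eqP->.
Qed.

(** * Sextuples in sets with a collinear triple *)

Definition spread6 (R : {set 'rV[K]_4}) :=
  exists ps, [/\ {subset ps <= R}, size ps = 6%N & spread ps].

(** The sextuple ends with [x], [y], [z] on [l]. Counted off [H], in [H] off [l], and on [l], its
    layers are 2 + 1 + 3 if two points lie off [H], 1 + 2 + 3 if just one does, and 0 + 3 + 3 if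
    none does. *)
Lemma collinear_spread6 (R : {set 'rV[K]_4}) x y z :
    pairwise_free R -> (2 * q + 1 < #|R|)%N ->
    x \in R -> y \in R -> z \in R -> x != y -> x != z -> y != z ->
    z \in <<[:: x; y]>>%VS ->
  spread6 R.
Proof.
move=> freeR cardR xR yR zR xy xz yz; set l := (<<_>>)%VS => zl.
have q_gt1 : (1 < q)%N := card_finNzRing_gt1 K.
have freexy : free [:: x; y] by apply: freeR.
have diml : \dim l = 2%N by apply/eqP.
have xl : x \in l by rewrite memv_span ?mem_head.
have yl : y \in l by rewrite memv_span // !inE eqxx orbT.
have xyzl : {subset [:: x; y; z] <= l}.
  by move=> v; rewrite !inE => /or3P[]/eqP->.
have xyzR : {subset [:: x; y; z] <= R}.
  by move=> v; rewrite !inE => /or3P[]/eqP->.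
have sp : spread [:: x; y; z] by apply: spread3; apply: freeR.
(* At most q + 1 of the at least 2q + 2 points lie on [l]. *)
have card_off : (q < #|R :\: pts l|)%N.
  have lb : (#|R :&: pts l| <= q.+1)%N := line_bound freeR xR yR xy.
  rewrite ltnNge; apply: contraL cardR => off_le; rewrite -leqNgt.
  rewrite (card_split R (pts l)) (leq_trans (leq_add lb off_le)) //.
  by rewrite mul2n -addnn addn1.
have /card_gt0P[u] : (0 < #|R :\: pts l|)%N.
  exact: leq_ltn_trans card_off.
rewrite !inE => /andP[ul uR].
pose H := (<<[:: u; x; y]>>)%VS.
have dimH : \dim H = 3%N by apply/eqP; rewrite -/(free _) free_cons ul.
have lH : (l <= H)%VS by rewrite /H span_cons addvSr.
have uH : u \in H by rewrite memv_span ?mem_head.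
have dimf : \dim {:'rV[K]_4} = (\dim H).+1 by rewrite dimvf dimH.
have dimHl : \dim H = (\dim l).+1 by rewrite dimH diml.
have freeR1 v : v \in R -> free [:: v].
  move=> vR; have [->|/(freeR _ _ vR xR)] := eqVneq v x.
    exact: (@catl_free _ _ [:: y] [:: x]).
  exact: (@catl_free _ _ [:: x] [:: v]).
have [/card_gt1P[w1 [w2 []]]|] := ltnP 1 #|R :\: pts H|.
  rewrite !inE => /andP[w1H w1R] /andP[w2H w2R] w12.
  exists ([:: w1; w2] ++ [:: u] ++ [:: x; y; z]); split=> //.
    move=> v; rewrite !mem_cat !inE => /or3P[/orP[]/eqP->|/eqP->|vx] //.
    by rewrite xyzR ?inE.
  apply: (spread_flag (subvf H) dimf); first exact: freeR.
  - by move=> v; rewrite !inE memvf => /orP[]/eqP->.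
  - move=> v; rewrite mem_cat !inE => /orP[/eqP->//|vx].
    by apply/(subvP lH)/xyzl; rewrite !inE.
  apply: (spread_flag lH dimHl) => //; first exact: freeR1.
  by move=> v; rewrite !inE => /eqP->; rewrite uH.
have [/eqP|/card_gt0P[w wRH] card_offH] := posnP #|R :\: pts H|.
  rewrite cards_eq0 setD_eq0 => /subsetP RH _.
  have {}RH v : v \in R -> v \in H by move/RH; rewrite inE.
  have /card_gt1P[u1 [u2 []]] : (1 < #|R :\: pts l|)%N.
    exact: ltn_trans card_off.
  rewrite !inE => /andP[u1l u1R] /andP[u2l u2R] u12.
  pose l' := (<<[:: u1; u2]>>)%VS.
  have freeu12 : free [:: u1; u2] by apply: freeR.
  have diml' : \dim l' = 2%N by apply/eqP.
  (* Three noncollinear points off [l] are wanted. If all those points lay on [l'], they would avoid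
     the point where the coplanar lines [l] and [l'] meet, so there would be at most q of them. *)
  have [Rl'|] := boolP (R :\: pts l \subset pts l').
    suff : (#|R :\: pts l| <= q)%N by rewrite leqNgt card_off.
    have {}Rl' v : v \in R -> v \notin l -> v \in l'.
      by move=> vR vl; have := subsetP Rl' v; rewrite !inE vR vl; apply.
    have dimcap : \dim (l :&: l') = 1%N.
      have sum_le : (\dim (l + l') <= 3)%N.
        apply: (@leq_trans (\dim H)); last by rewrite dimH.
        apply/dimvS; rewrite subv_add lH; apply/span_subvP => v.
        by rewrite !inE => /orP[]/eqP->; apply: RH.
      have cap_lt : (\dim (l :&: l') < 2)%N.
        apply: (@leq_trans (\dim l')); last by rewrite diml'.
        rewrite (ltn_leqif (dimv_leqif_sup (capvSr l l'))).
        apply/subvPn; exists u1; first by rewrite Rl'.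
        by rewrite memv_cap (negPf u1l).
      move: sum_le cap_lt (dimv_sum_cap l l'); rewrite diml diml'.
      case: (\dim (l :&: l')) => [|[|]] // sum_le _ dim_sum.
      by rewrite addn0 in dim_sum; rewrite dim_sum in sum_le.
    apply: (@pencil_bound _ 0%VS (l :&: l')%VS l').
    - exact: sub0v.
    - exact: capvSr.
    - by rewrite dimcap dimv0.
    - by rewrite diml' dimcap.
    - move=> s; rewrite !inE memv_cap => /andP[sl sR].
      by rewrite Rl' // (negPf sl).
    move=> s t; rewrite !inE => /andP[sl sR] /andP[tl tR] st.
    rewrite add0v; apply: span_free_eq; rewrite ?diml' ?freeR //.
    by move=> v; rewrite !inE => /orP[]/eqP->; apply: Rl'.
  case/subsetPn => w; rewrite !inE => /andP[wl wR] wl'.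
  exists ([:: w; u1; u2] ++ [:: x; y; z]); split=> //.
    move=> v; rewrite mem_cat => /orP[|/xyzR//].
    by rewrite !inE => /or3P[]/eqP->.
  apply: (spread_flag lH dimHl) => //; first by rewrite free_cons wl'.
  by move=> v; rewrite !inE => /or3P[]/eqP->; rewrite RH.
move: wRH; rewrite !inE => /andP[wH wR].
(* At least q + 1 >= 3 points lie off [l], and only one of them is off [H]. *)
have /card_gt1P[u1 [u2 []]] : (1 < #|(R :\: pts l) :&: pts H|)%N.
  rewrite ltnNge; apply: contraL card_off => in_le1; rewrite -leqNgt.
  rewrite (card_split _ (pts H)) (leq_trans (leq_add in_le1 _) q_gt1) //.
  apply: leq_trans card_offH.
  by rewrite subset_leq_card // setSD // subsetDl.
rewrite !inE => /andP[/andP[u1l u1R] u1H] /andP[/andP[u2l u2R] u2H] u12.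
exists ([:: w] ++ [:: u1; u2] ++ [:: x; y; z]); split=> //.
  move=> v; rewrite !mem_cat !inE => /or3P[/eqP->|/orP[]/eqP->|vx] //.
  by rewrite xyzR ?inE.
apply: (spread_flag (subvf H) dimf); first exact: freeR1.
- by move=> v; rewrite !inE memvf => /eqP->.
- move=> v; rewrite mem_cat !inE => /orP[/orP[]/eqP->//|vx].
  by apply/(subvP lH)/xyzl; rewrite !inE.
apply: (spread_flag lH dimHl) => //; first exact: freeR.
by move=> v; rewrite !inE => /orP[]/eqP->; rewrite ?u1H ?u2H.
Qed.

(** * Sextuples in sets without collinear triples *)

(** Three points off [H] are completed by [z], [x], [y]. With two or one off [H], the sextuple ends
    with [x], [y] on [l] and its layers are 2 + 2 + 2 or 1 + 3 + 2. A set inside [H] would be too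
    small. *)
Lemma cap_spread6 (R : {set 'rV[K]_4}) :
    pairwise_free R -> (2 * q + 1 < #|R|)%N ->
    (forall x y z, x \in R -> y \in R -> z \in R ->
       x != y -> y != z -> z != x -> free [:: x; y; z]) ->
  spread6 R.
Proof.
move=> freeR cardR free3; have q_gt1 : (1 < q)%N := card_finNzRing_gt1 K.
have card5 : (5 <= 2 * q + 1)%N by rewrite (leq_add2r 1 4) (leq_mul2l 2 2).
have /card_gt2P[x [y [z [[xR yR zR] [xy yz zx]]]]] : (2 < #|R|)%N.
  exact: leq_ltn_trans (leq_trans _ card5) cardR.
pose l := (<<[:: x; y]>>)%VS; pose H := (<<[:: z; x; y]>>)%VS.
have freexy : free [:: x; y] by apply: freeR.
have diml : \dim l = 2%N by apply/eqP.
have dimH : \dim H = 3%N by apply/eqP; apply: free3.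
have lH : (l <= H)%VS by rewrite /H span_cons addvSr.
have dimf : \dim {:'rV[K]_4} = (\dim H).+1 by rewrite dimvf dimH.
have dimHl : \dim H = (\dim l).+1 by rewrite dimH diml.
have xl : x \in l by rewrite memv_span ?mem_head.
have yl : y \in l by rewrite memv_span // !inE eqxx orbT.
have xyl : {subset [:: x; y] <= l} by exact: memv_span.
have zxyH : {subset [:: z; x; y] <= H} by exact: memv_span.
have zxyR : {subset [:: z; x; y] <= R}.
  by move=> v; rewrite !inE => /or3P[]/eqP->.
have xyR : {subset [:: x; y] <= R} by move=> v; rewrite !inE => /orP[]/eqP->.
have sp3 : spread [:: z; x; y].
  by apply: spread3; apply: freeR => //; rewrite eq_sym.
have sp2 : spread [:: x; y] by case: sp3.
have off v : v \in R -> v != x -> v != y -> v \notin l.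
  move=> vR vx vy; suff : free [:: v; x; y] by rewrite free_cons => /andP[].
  by apply: free3 => //; rewrite eq_sym.
have freeR1 v : v \in R -> free [:: v].
  move=> vR; have [->|/(freeR _ _ vR xR)] := eqVneq v x.
    exact: (@catl_free _ _ [:: y] [:: x]).
  exact: (@catl_free _ _ [:: x] [:: v]).
have cardI : (#|R| <= #|(R :&: pts H) :\: [set x; y]| + 2 + #|R :\: pts H|)%N.
  rewrite (card_split R (pts H)) leq_add2r.
  rewrite (card_split (R :&: pts H) [set x; y]) addnC leq_add2l.
  have := subset_leq_card (subsetIr (R :&: pts H) [set x; y]).
  by rewrite cards2 xy.
(* There are at least six points: setting aside [x], [y] and at most [b] points off [H] leaves more
   than [a]. *)
have card_inner a b : (a + 2 + b <= 5)%N -> (#|R :\: pts H| <= b)%N ->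
    (a < #|(R :&: pts H) :\: [set x; y]|)%N.
  move=> ab5 off_le; rewrite ltnNge; apply: contraL cardR => in_le.
  rewrite -leqNgt (leq_trans cardI) // (leq_trans _ card5) //.
  by rewrite (leq_trans _ ab5) // leq_add // leq_add.
have inner v : v \in (R :&: pts H) :\: [set x; y] ->
    v \in R /\ (v \in H) && (v \notin l).
  rewrite !inE negb_or => /and3P[/andP[vx vy] vR vH].
  by rewrite vH off.
have [/card_gt2P[w1 [w2 [w3 []]]]|] := ltnP 2 #|R :\: pts H|.
  rewrite !inE => -[/andP[w1H w1R] /andP[w2H w2R] /andP[w3H w3R]] [w12 w23 w31].
  exists ([:: w1; w2; w3] ++ [:: z; x; y]); split=> //.
    move=> v; rewrite mem_cat => /orP[|/zxyR//].
    by rewrite !inE => /or3P[]/eqP->.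
  apply: (spread_flag (subvf H) dimf) => //; first exact: free3.
  by move=> v; rewrite !inE memvf => /or3P[]/eqP->.
have [/card_gt1P[w1 [w2 []]]|] := ltnP 1 #|R :\: pts H|.
  rewrite !inE => /andP[w1H w1R] /andP[w2H w2R] w12 card_le2.
  have /card_gt1P[u1 [u2 []]] : (1 < #|(R :&: pts H) :\: [set x; y]|)%N.
    exact: card_inner card_le2.
  move=> /inner[u1R u1l] /inner[u2R u2l] u12.
  exists ([:: w1; w2] ++ [:: u1; u2] ++ [:: x; y]); split=> //.
    move=> v; rewrite !mem_cat => /or3P[||/xyR//].
      by rewrite !inE => /orP[]/eqP->.
    by rewrite !inE => /orP[]/eqP->.
  apply: (spread_flag (subvf H) dimf); first exact: freeR.
  - by move=> v; rewrite !inE memvf => /orP[]/eqP->.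
  - move=> v; rewrite mem_cat => /orP[|/xyl/(subvP lH)//].
    by rewrite !inE => /orP[]/eqP->; [case/andP: u1l | case/andP: u2l].
  apply: (spread_flag lH dimHl) => //; first exact: freeR.
  by move=> v; rewrite !inE => /orP[]/eqP->.
have [/eqP|/card_gt0P[w wRH] card_le1 _] := posnP #|R :\: pts H|.
  rewrite cards_eq0 setD_eq0 => /subsetP RH _ _.
  have {}RH v : v \in R -> v \in H by move/RH; rewrite inE.
  (* Project from [x]: each of the q lines of [H] through [x] other than [l] carries at most one
     further point. This allows only q + 2 points in all, fewer than 2q + 2. *)
  suff : (#|R :\: [set x; y]| <= q)%N.
    have in_le := subset_leq_card (subsetIr R [set x; y]).
    move=> off_le; have := leq_add in_le off_le.
    rewrite -card_split cards2 xy => /(leq_trans cardR).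
    rewrite mul2n -addnn -addnA [(_ + q)%N]addnC ltn_add2l addn1 !ltnS leqNgt.
    by rewrite (ltnW q_gt1).
  have x_neq0 : x != 0 by rewrite -seq1_free freeR1.
  apply: (@pencil_bound _ <[x]>%VS l H) => //.
  - by rewrite diml (dim_vline x) x_neq0.
  - move=> s; rewrite !inE negb_or => /andP[/andP[sx sy] sR].
    by rewrite RH // off.
  move=> s t; rewrite !inE !negb_or.
  move=> /andP[/andP[sx sy] sR] /andP[/andP[tx ty] tR] st.
  rewrite -span_cons; apply: span_free_eq => //.
    by apply: free3 => //; rewrite eq_sym.
  by move=> v; rewrite !inE => /or3P[]/eqP->; apply: RH.
move: wRH; rewrite !inE => /andP[wH wR].
have /card_gt2P[u1 [u2 [u3 []]]] : (2 < #|(R :&: pts H) :\: [set x; y]|)%N.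
  exact: card_inner card_le1.
move=> [/inner[u1R u1l] /inner[u2R u2l] /inner[u3R u3l]] [u12 u23 u31].
exists ([:: w] ++ [:: u1; u2; u3] ++ [:: x; y]); split=> //.
  move=> v; rewrite !mem_cat => /or3P[||/xyR//].
    by rewrite !inE => /eqP->.
  by rewrite !inE => /or3P[]/eqP->.
apply: (spread_flag (subvf H) dimf); first exact: freeR1.
- by move=> v; rewrite !inE memvf => /eqP->.
- move=> v; rewrite mem_cat => /orP[|/xyl/(subvP lH)//].
  rewrite !inE => /or3P[]/eqP->.
  - by case/andP: u1l.
  - by case/andP: u2l.
  - by case/andP: u3l.
apply: (spread_flag lH dimHl) => //; first exact: free3.
by move=> v; rewrite !inE => /or3P[]/eqP->.
Qed.

Lemma large_spread6 (R : {set 'rV[K]_4}) :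
  pairwise_free R -> (2 * q + 1 < #|R|)%N -> spread6 R.
Proof.
move=> freeR cardR.
case: (boolP [exists x in R, exists y in R, exists z in R,
  [&& x != y, y != z, z != x & z \in <<[:: x; y]>>%VS]]).
  case/exists_inP=> x xR /exists_inP[y yR /exists_inP[z zR]].
  case/and4P=> xy yz zx zl.
  apply: (collinear_spread6 freeR cardR xR yR zR) => //.
  by rewrite eq_sym.
move=> no3; apply: cap_spread6 => // x y z xR yR zR xy yz zx.
rewrite free_cons freeR // andbT; apply: contra no3 => xl.
apply/exists_inP; exists y => //; apply/exists_inP; exists z => //.
by apply/exists_inP; exists x => //; rewrite yz zx xy.
Qed.

(** * From projective points to representative vectors *)

Lemma proj_space_repr n (P : {set 'rV[K]_n.+1}) v :
  P \in proj_space K n -> v \in P -> P = proj_point v /\ v != 0.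
Proof.
case/imsetP=> u; rewrite inE => u_neq0 -> /imsetP[a]; rewrite inE => a_neq0 ->.
split; last by rewrite scaler_eq0 negb_or a_neq0.
apply/setP=> w; apply/imsetP/imsetP=> -[b]; rewrite inE => b_neq0 ->.
  exists (b / a); first by rewrite inE mulf_neq0 ?invr_eq0.
  by rewrite scalerA divfK.
by exists (b * a); rewrite ?inE ?mulf_neq0 // scalerA.
Qed.

(** A representative determines its point, so choosing one per point is injective; proportional
    representatives would belong to the same point. *)
Lemma proj_representatives n (Z : {set {set 'rV[K]_n.+1}}) :
    Z \subset proj_space K n ->
  exists2 R : {set 'rV[K]_n.+1}, #|R| = #|Z| &
    pairwise_free R /\ {in R, forall v, exists2 P, P \in Z & v \in P}.
Proof.
(* For [P] in [Z] the default [0] is never reached, since a projective point is nonempty. *)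
move=> /subsetP ZS; pose rep (P : {set 'rV[K]_n.+1}) := odflt 0 [pick v in P].
have repP P : P \in Z -> rep P \in P.
  move=> /ZS /imsetP[v _ ->]; rewrite /rep; case: pickP => //= /(_ v).
  by case/imsetP; exists 1; rewrite ?inE ?oner_eq0 ?scale1r.
have repE P : P \in Z -> P = proj_point (rep P) /\ rep P != 0.
  by move=> PZ; apply: proj_space_repr; [apply: ZS | apply: repP].
exists (rep @: Z).
  apply: card_in_imset => P Q /repE[PE _] /repE[QE _] eq_rep.
  by rewrite PE eq_rep -QE.
split; last by move=> _ /imsetP[P PZ ->]; exists P; rewrite ?repP.
move=> _ _ /imsetP[P PZ ->] /imsetP[Q QZ ->].
have [[PE P0] [QE Q0]] := (repE P PZ, repE Q QZ).
rewrite free_cons seq1_free Q0 andbT span_seq1; apply: contra.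
case/vlineP=> a PaQ; suff <- : P = Q by [].
rewrite PE; have /proj_space_repr[] // : rep P \in Q; last by exact: ZS.
rewrite QE; apply/imsetP; exists a => //; rewrite inE.
by apply: contraNneq P0 => a0; rewrite PaQ a0 scale0r.
Qed.

End FinitePointSets.

(** * Bounding the common zeros of five quadrics *)

Theorem theorem5p1 (Fq : finFieldType) (F : 5.-tuple (dhomog 4 Fq 2)) :
  (3 < #|Fq|)%N ->
  free F ->
  (#|proj_zeros [seq (p : {mpoly Fq[4]}) | p : dhomog 4 Fq 2 <- F]|
     <= 2 * #|Fq| + 1)%N.
Proof.
move=> _ freeF; set Z := proj_zeros _.
have /proj_representatives[R <- [freeR RZ]] : Z \subset proj_space Fq 3.
  by apply/subsetP=> P; rewrite inE => /andP[].
rewrite leqNgt; apply/negP => /(large_spread6 freeR)[ps [psR size_ps sps]].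
(* Once the quadrics of [F] are known to vanish on [ps], the dimension bound reads 5 + 6 <= 10,
   which is absurd. *)
suff /(spread_bound freeF sps) :
    forall (p : dhomog 4 Fq 2) v, p \in (F : seq _) -> v \in ps ->
      (p : {mpoly Fq[4]}).@[fun i => v 0 i] = 0.
  by rewrite size_tuple size_ps.
move=> p v pF /psR /RZ[P]; rewrite inE => /andP[_ /forall_inP Pv] /Pv.
by move=> /allP/(_ _ (map_f _ pF))/eqP.
Qed.
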